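(* Let $f$ be defined and continuous on $\widetilde G=G\cup\widehat G$. Let $G^o\subset G$ be a connected open set, let $\widehat G^o\subset\partial G^o\cap\widehat G$, and suppose that $f$ satisfies the Lipschitz condition with respect to $y$ locally on $\widetilde G^o=G^o\cup\widehat G^o$. Then $\widetilde G^o$ is a uniqueness set of the equation $y'=f(x,y)$.
   Context: Setting. $G\subset\mathbb{R}^2$ is a connected open set, $\widehat G\subset\partial G$, $\widetilde G=G\cup\widehat G$, $f:\widetilde G\to\mathbb{R}$; $\widehat G$ contains all points of $\partial G$ at which $f$ can be defined as a continuous function. The symbol $\langle a,b\rangle$ with $a<b$ denotes an interval with each endpoint included or not. A solution of $y'=f(x,y)$ on $\langle a,b\rangle$ is a differentiable function $\varphi$ on $\langle a,b\rangle$ with $(x,\varphi(x))\in\widetilde G$ and $\varphi'(x)=f(x,\varphi(x))$ for all $x\in\langle a,b\rangle$. It is a solution of the initial value problem at $(x_0,y_0)\in\widetilde G$ if $x_0\in\langle a,b\rangle$ and $\varphi(x_0)=y_0$. A solution on $\langle a,b\rangle$ is extendable to an interval $J$ if there is a solution on $\langle a,b\rangle\cup J$ coinciding with it on $\langle a,b\rangle$. Local Lipschitz condition: $f$ satisfies the Lipschitz condition with respect to $y$ locally on a set $S$ if for every $(x_0,y_0)\in S$ there are $c>0$ and $L>0$ such that $|f(x,y_1)-f(x,y_2)|\le L|y_1-y_2|$ for all $(x,y_1),(x,y_2)\in S\cap\overline V_c(x_0,y_0)$, where $\overline V_c(x_0,y_0)=\{(x,y):|x-x_0|\le c,\ |y-y_0|\le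 c\}$. Uniqueness points in $G$: $(x_0,y_0)\in G$ is a uniqueness point if there is an open interval $(\alpha,\beta)\ni x_0$ such that all solutions of the initial value problem at $(x_0,y_0)$ are extendable to $(\alpha,\beta)$ and any two of them, extended if needed, coincide on $(\alpha,\beta)$. Uniqueness points in $\widehat G$: the solution of the initial value problem at $(x_0,y_0)\in\widehat G$ is right locally unique if a solution exists on some $[x_0,b)$ and there is an interval $[x_0,\beta)$ such that all solutions of this problem are extendable to $[x_0,\beta)$ and any two of them, extended if needed, coincide on $[x_0,\beta)$; left local uniqueness is defined analogously. The point $(x_0,y_0)\in\widehat G$ is a uniqueness point if the solution of the initial value problem at it is left locally unique and cannot be extended to the right beyond $x_0$, or is right locally unique and cannot be extended to the left beyond $x_0$, or is both left and right locally unique. A point of $\widehat G$ at which the initial value problem has no solution is also regarded as a uniqueness point. A set $\widetilde G^o=G^o\cup\widehat G^o$, where $G^o\subset G$ is a connected open set and $\widehat G^o$ is a set of boundary points of $G^o$, is a uniqueness set of the equation if every point of $G^o$ and every point of $\widehat G^o$ is a uniqueness point.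
   Formalization: At points of Ĝᵒ, uniqueness (and existence or extendability) is asserted only among solutions whose graph lies in G̃ ∩ closure(Gᵒ); with arbitrary solutions in G̃ the claim is false when Gᵒ ≠ G. For Gᵒ = G nothing changes. *)

(* Defs.v *)
From HB Require Import structures.
From mathcomp Require Import all_boot all_order all_algebra.
From mathcomp Require Import all_classical all_reals all_analysis.

Set Implicit Arguments.
Unset Strict Implicit.
Unset Printing Implicit Defensive.

Import Order.TTheory GRing.Theory Num.Theory.
Import numFieldNormedType.Exports.

Local Open Scope classical_set_scope.
Local Open Scope ring_scope.

Definition boundary (T : topologicalType) (A : set T) : set T :=
  closure A `\` interior A.

(* Only the values of [f] on the domain under consideration matter: every
   definition below reads [f] on that domain alone. *)

Definition limit_exists_at (R : realType) (f : R * R -> R) (G : set (R * R))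
    (p : R * R) : Prop :=
  exists l : R, f @ within G (nbhs p) --> l.

Definition locally_lipschitz_in_y (R : realType) (f : R * R -> R)
    (S : set (R * R)) : Prop :=
  forall x0 y0 : R, S (x0, y0) ->
  exists c L : R, [/\ 0 < c, 0 < L &
    forall x y1 y2 : R,
      S (x, y1) -> S (x, y2) ->
      `|x - x0| <= c -> `|y1 - y0| <= c -> `|y2 - y0| <= c ->
      `|f (x, y1) - f (x, y2)| <= L * `|y1 - y2|].

(* The intervals <a, b>, a < b: [la] (resp. [lb]) decides whether the endpoint
   [a] (resp. [b]) belongs to the interval. *)
Definition angle_interval (R : realType) (I : set R) : Prop :=
  exists (a b : R) (la lb : bool),
    a < b /\ I = [set` Interval (BSide la a) (BSide (~~ lb) b)].

(* Derivative relative to [I]: one-sided at the endpoints contained in [I]. *)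
Definition has_derivative_in (R : realType) (I : set R) (phi : R -> R)
    (x d : R) : Prop :=
  (fun t => (phi t - phi x) / (t - x)) @ within I x^' --> d.

(* Solutions of y' = f(x, y) on [I] with graph in [D]. *)
Definition solution (R : realType) (D : set (R * R)) (f : R * R -> R)
    (I : set R) (phi : R -> R) : Prop :=
  angle_interval I /\
  forall x, I x -> D (x, phi x) /\ has_derivative_in I phi x (f (x, phi x)).

Definition ivp_solution (R : realType) (D : set (R * R)) (f : R * R -> R)
    (p : R * R) (I : set R) (phi : R -> R) : Prop :=
  [/\ solution D f I phi, I p.1 & phi p.1 = p.2].

Definition extension (R : realType) (D : set (R * R)) (f : R * R -> R)
    (I : set R) (phi : R -> R) (J : set R) (psi : R -> R) : Prop :=
  solution D f (I `|` J) psi /\ forall x, I x -> psi x = phi x.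

Definition extendable (R : realType) (D : set (R * R)) (f : R * R -> R)
    (I : set R) (phi : R -> R) (J : set R) : Prop :=
  exists psi : R -> R, extension D f I phi J psi.

Definition ivp_unique_on (R : realType) (D : set (R * R)) (f : R * R -> R)
    (p : R * R) (J : set R) : Prop :=
  (forall I phi, ivp_solution D f p I phi -> extendable D f I phi J) /\
  (forall I1 phi1 I2 phi2 psi1 psi2,
     ivp_solution D f p I1 phi1 -> ivp_solution D f p I2 phi2 ->
     extension D f I1 phi1 J psi1 -> extension D f I2 phi2 J psi2 ->
     forall x, J x -> psi1 x = psi2 x).

Definition interior_uniqueness_point (R : realType) (D : set (R * R))
    (f : R * R -> R) (p : R * R) : Prop :=
  exists alpha beta : R, [/\ alpha < p.1, p.1 < beta &
    ivp_unique_on D f p `]alpha, beta[].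

Definition right_locally_unique (R : realType) (D : set (R * R))
    (f : R * R -> R) (p : R * R) : Prop :=
  (exists (b : R) (phi : R -> R),
     p.1 < b /\ ivp_solution D f p `[p.1, b[ phi) /\
  (exists beta : R, p.1 < beta /\ ivp_unique_on D f p `[p.1, beta[).

Definition left_locally_unique (R : realType) (D : set (R * R))
    (f : R * R -> R) (p : R * R) : Prop :=
  (exists (a : R) (phi : R -> R),
     a < p.1 /\ ivp_solution D f p `]a, p.1] phi) /\
  (exists alpha : R, alpha < p.1 /\ ivp_unique_on D f p `]alpha, p.1]).

Definition extendable_right (R : realType) (D : set (R * R))
    (f : R * R -> R) (p : R * R) : Prop :=
  exists (I : set R) (phi : R -> R) (b : R),
    [/\ ivp_solution D f p I phi, p.1 < b & extendable D f I phi `[p.1, b]].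

Definition extendable_left (R : realType) (D : set (R * R))
    (f : R * R -> R) (p : R * R) : Prop :=
  exists (I : set R) (phi : R -> R) (a : R),
    [/\ ivp_solution D f p I phi, a < p.1 & extendable D f I phi `[a, p.1]].

Definition boundary_uniqueness_point (R : realType) (D : set (R * R))
    (f : R * R -> R) (p : R * R) : Prop :=
  [\/ left_locally_unique D f p /\ ~ extendable_right D f p,
      right_locally_unique D f p /\ ~ extendable_left D f p,
      left_locally_unique D f p /\ right_locally_unique D f p |
      ~ exists (I : set R) (phi : R -> R), ivp_solution D f p I phi].

(* [Go `|` Goh] is a uniqueness set of y' = f(x, y), f given on [G `|` Gh].

   At a point of [Goh], which is a boundary point of [Go], the solutions
   considered are those whose graph lies in the closure of [Go].  When
   [Go = G] this is no restriction, since [Gh] lies in the boundary of [G].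
   For a smaller [Go] it is needed, because a solution through a boundary point
   of [Go] may otherwise run outside [Go], where nothing is known.  Take
   G = {x > 0}, Gh = {x = 0}, f(x, y) = - 3 |y|^(2/3) for y < 0 and
   f(x, y) = 0 for y >= 0, Go = {x > 0, y > 0} and Goh = {(0, 0)}.  Then f = 0
   on [Go `|` Goh], whereas y = 0 and y = - x^3 both solve the initial value
   problem at (0, 0) in [G `|` Gh]. *)
Definition uniqueness_set (R : realType) (G Gh : set (R * R))
    (f : R * R -> R) (Go Goh : set (R * R)) : Prop :=
  (forall p, Go p -> interior_uniqueness_point (G `|` Gh) f p) /\
  (forall p, Goh p ->
     boundary_uniqueness_point ((G `|` Gh) `&` closure Go) f p).

(* Main.v *)
(* Two solutions through p that stay in a box where f is Lipschitz in y along
   them agree: the set where they agree is closed, and open by the mean value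
   theorem. A given solution in the box can then be glued to any other one, so
   uniqueness at p only needs one solution near p. At an interior point it is
   given by Picard iteration; at a boundary point either no solution exists or a
   restriction of an existing one is used, on each side where there is one. The
   Lipschitz condition passes from Go to solutions in closure Go because the
   projections of Go near their two graphs are open and dense, hence meet. *)
Require Import Defs.
From HB Require Import structures.
From mathcomp Require Import all_boot all_order all_algebra.
From mathcomp Require Import all_classical all_reals all_analysis.
From mathcomp Require Import ring lra.
Set Implicit Arguments.
Unset Strict Implicit.
Unset Printing Implicit Defensive.

Import Order.TTheory GRing.Theory Num.Theory.
Import numFieldNormedType.Exports.
Local Open Scope classical_set_scope.
Local Open Scope ring_scope.

(** * Intervals, one-sided derivatives and gluing *)

(** This form is free of endpoint cases, which makes unions and intersections of such intervals easy
    to handle. *)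
Lemma angle_intervalP (R : realType) (I : set R) :
  angle_interval I <->
  [/\ is_interval I, has_lbound I, has_ubound I &
      exists x y, [/\ I x, I y & x < y]].
Proof.
split=> [[a [b [la [lb [ab ->]]]]]|[/is_intervalP II lI uI [x [y [Ix Iy xy]]]]].
  split; first exact: interval_is_interval.
  - by exists a => t /=; rewrite itv_boundlr => /andP[/= + _]; case: la => //= /ltW.
  - exists b => t /=; rewrite itv_boundlr => /andP[/= _].
    by case: lb => //= /ltW.
  - exists ((2 * a + b) / 3), ((a + 2 * b) / 3); split; last by lra.
    + rewrite /= itv_boundlr /=.
      by case: la lb => -[]; rewrite /= ?bnd_simp; apply/andP; split; lra.
    + rewrite /= itv_boundlr /=.
      by case: la lb => -[]; rewrite /= ?bnd_simp; apply/andP; split; lra.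
(* A bounded interval is its own [Rhull]: the flags record whether the infimum and the supremum are
   attained. *)
exists (inf I), (sup I), `[< I (inf I) >], `[< I (sup I) >]; split.
  by rewrite (le_lt_trans (ge_inf lI Ix))// (lt_le_trans xy)// ub_le_sup.
by rewrite {1}II /Rhull (asboolT lI) (asboolT uI).
Qed.

Lemma angle_intervalU (R : realType) (I J : set R) (x : R) :
  angle_interval I -> angle_interval J -> I x -> J x -> angle_interval (I `|` J).
Proof.
move=> /angle_intervalP[II [a Ia] [b Ib] [s [t [Is It st]]]].
move=> /angle_intervalP[IJ [c Jc] [d Jd] _] Ix Jx.
apply/angle_intervalP; split.
- move=> u v Iu Iv w /andP[uw wv].
  (* The common point [x] splits the segment: [w] lies between [x] and one of [u], [v], hence in the
     interval containing that one. *)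
  have [wx|xw] := leP w x.
    by case: Iu => Iu; [left; apply: (II u x)|right; apply: (IJ u x)];
      rewrite ?uw.
  by case: Iv => Iv; [left; apply: (II x v)|right; apply: (IJ x v)];
    rewrite ?(ltW xw).
- exists (Num.min a c) => u [/Ia|/Jc]; rewrite ge_min => ->//.
  by rewrite orbT.
- exists (Num.max b d) => u [/Ib|/Jd]; rewrite le_max => ->//.
  by rewrite orbT.
- by exists s, t; split => //; left.
Qed.

Lemma angle_interval_is_interval (R : realType) (I : set R) :
  angle_interval I -> is_interval I.
Proof. by move=> /angle_intervalP[]. Qed.

(** The division-free estimate is trivial at [t = x], so the puncture disappears and the condition
    is easy to restrict, localise and glue. *)
Lemma has_derivative_inP (R : realType) (I : set R) (phi : R -> R) (x d : R) :
  has_derivative_in I phi x d <->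
  forall e, 0 < e -> exists2 r, 0 < r & forall t, I t -> `|t - x| < r ->
    `|phi t - phi x - d * (t - x)| <= e * `|t - x|.
Proof.
have quotE t : t != x -> phi t - phi x - d * (t - x) =
    - (d - (phi t - phi x) / (t - x)) * (t - x).
  by move=> tx; field; rewrite subr_eq0.
split=> [/cvgrPdist_le h e e0|h].
  have /nbhs_ballP[r /= r0 rP] := h e e0.
  exists r => // t It tr.
  have [->|tx] := eqVneq t x; first by rewrite !subrr mulr0 subrr normr0 mulr0.
  rewrite quotE// normrM normrN ler_wpM2r//.
  by apply: rP => //; rewrite /ball/= distrC.
apply/cvgrPdist_le => e e0; have [r r0 rP] := h e e0.
apply/nbhs_ballP; exists r => //= t tr tx It.
have := rP t It; rewrite quotE// normrM normrN ler_pM2r ?normr_gt0 ?subr_eq0//.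
by apply; rewrite distrC.
Qed.

Lemma has_derivative_in_sub (R : realType) (I J : set R) (phi : R -> R) x d :
  J `<=` I -> has_derivative_in I phi x d -> has_derivative_in J phi x d.
Proof.
move=> JI /has_derivative_inP h; apply/has_derivative_inP => e /h[r r0 rP].
by exists r => // t /JI It; exact: rP.
Qed.

Lemma has_derivative_in_continuous (R : realType) (I : set R) (phi : R -> R) x d :
  has_derivative_in I phi x d ->
  forall e, 0 < e -> exists2 r, 0 < r &
    forall t, I t -> `|t - x| < r -> `|phi t - phi x| < e.
Proof.
move=> /has_derivative_inP/(_ 1 ltr01)[r r0 rP] e e0.
(* The first-order estimate with error 1 bounds the increment of [phi] by (|d| + 1) |t - x|. *)
exists (Num.min r (e / (`|d| + 1))).
  by rewrite lt_min r0/= divr_gt0// ltr_wpDl.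
move=> t It; rewrite lt_min => /andP[tr te].
rewrite -(subrK (d * (t - x)) (phi t - phi x)) (le_lt_trans (ler_normD _ _))//.
rewrite (le_lt_trans (lerD (rP _ It tr) (lexx _)))// normrM -mulrDl addrC.
by rewrite mulrC -ltr_pdivlMr// ltr_wpDl.
Qed.

(** At an inner point of [I] the relative derivative is the ordinary one, which is what the mean
    value theorem asks for. *)
Lemma has_derivative_in_ball (R : realType) (I : set R) (phi : R -> R) x d e :
  0 < e -> ball x e `<=` I -> has_derivative_in I phi x d ->
  is_derive x 1 phi d.
Proof.
move=> e0 eI /has_derivative_inP h.
have c : h^-1 *: ((phi \o shift x) (h *: 1) - phi x) @[h --> 0^'] --> d.
  apply/cvgrPdist_le => e1 e10; have [r r0 rP] := h e1 e10.
  apply/nbhs_ballP; exists (Num.min r e) => /=; first by rewrite lt_min r0.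
  move=> t; rewrite /ball/= sub0r normrN lt_min => /andP[tr te] t0.
  have -> : d - t^-1 *: ((phi \o shift x) (t *: 1) - phi x)
      = - t^-1 * (phi (t + x) - phi x - d * (t + x - x)).
    by rewrite /= /GRing.scale/= mulr1; field.
  rewrite normrM normrN normfV ler_pdivrMl ?normr_gt0// [_ * e1]mulrC.
  rewrite addrK; have := rP (t + x); rewrite addrK; apply => //; apply: eI.
  by rewrite /ball/= opprD addrCA subrr addr0 normrN.
split; first by apply/cvg_ex; exists d.
exact: cvg_lim c.
Qed.

Lemma solution_sub (R : realType) (D : set (R * R)) f (I J : set R) phi :
  solution D f I phi -> J `<=` I -> angle_interval J -> solution D f J phi.
Proof.
move=> [_ h] JI aJ; split => // x /JI/h[? ?]; split => //.
exact: has_derivative_in_sub JI _.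
Qed.

Lemma solution_continuous (R : realType) (D : set (R * R)) f (I : set R) phi x e :
  solution D f I phi -> I x -> 0 < e -> exists2 r, 0 < r &
    forall t, I t -> `|t - x| < r -> `|phi t - phi x| < e.
Proof. by move=> [_ h] /h[_ /has_derivative_in_continuous]; apply. Qed.

(** Since [J] contains [z] but not [x], it lies on the side of [x] where [z] is. Its points at
    distance less than |z - x| from [x] are thus between [x] and [z], hence in [I]. Derivatives at
    [x] relative to the union therefore depend on [I] alone. *)
Lemma interval_setU_near (R : realType) (I J : set R) (z x : R) :
  is_interval I -> is_interval J -> I z -> J z -> I x -> ~ J x ->
  exists2 r, 0 < r & forall t, (I `|` J) t -> `|t - x| < r -> I t.
Proof.
move=> II IJ Iz Jz Ix Jx.
have zx : z != x by apply: contra_not_neq Jx => <-.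
exists `|z - x|; first by rewrite normr_gt0 subr_eq0.
move=> t [//|Jt] tx.
have [ltzx|ltxz|/eqP] := ltgtP z x; last by rewrite (negbTE zx).
- rewrite [`|z - x|]distrC (gtr0_norm (_ : 0 < x - z)) ?subr_gt0// in tx.
  move: tx; rewrite ltr_norml => /andP[h1 h2].
  have [tx|xt] := leP t x; first by apply: (II z x) => //; rewrite tx andbT; lra.
  by exfalso; apply: Jx; apply: (IJ z t) => //; rewrite !ltW.
- rewrite (gtr0_norm (_ : 0 < z - x)) ?subr_gt0// in tx.
  move: tx; rewrite ltr_norml => /andP[h1 h2].
  have [tx|xt] := leP x t; first by apply: (II x z) => //; rewrite tx /=; lra.
  by exfalso; apply: Jx; apply: (IJ t z) => //; rewrite !ltW.
Qed.

Definition glue (R : realType) (I : set R) (phi chi : R -> R) : R -> R :=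
  fun x => if `[< I x >] then phi x else chi x.

Lemma glue_in (R : realType) (I : set R) phi chi (x : R) :
  I x -> glue I phi chi x = phi x.
Proof. by rewrite /glue; case: asboolP. Qed.

Lemma glue_right (R : realType) (I J : set R) phi chi (x : R) :
  (forall t, I t -> J t -> phi t = chi t) -> J x -> glue I phi chi x = chi x.
Proof. by rewrite /glue; case: asboolP => // Ix h; exact: h. Qed.

Lemma has_derivative_in_eq (R : realType) (I : set R) phi psi x d :
  I x -> {in I, phi =1 psi} ->
  has_derivative_in I phi x d -> has_derivative_in I psi x d.
Proof.
move=> Ix e /has_derivative_inP h; apply/has_derivative_inP => eps /h[r r0 rP].
by exists r => // t It; rewrite -!e ?inE//; exact: rP.
Qed.

Lemma has_derivative_in_local (R : realType) (I J : set R) phi x d r :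
  0 < r -> (forall t, J t -> `|t - x| < r -> I t) ->
  has_derivative_in I phi x d -> has_derivative_in J phi x d.
Proof.
move=> r0 JI /has_derivative_inP h; apply/has_derivative_inP => e /h[s s0 sP].
exists (Num.min r s); first by rewrite lt_min r0.
by move=> t Jt; rewrite lt_min => /andP[/(JI _ Jt) It]; exact: sP.
Qed.

Lemma has_derivative_inU (R : realType) (I J : set R) phi x d :
  has_derivative_in I phi x d -> has_derivative_in J phi x d ->
  has_derivative_in (I `|` J) phi x d.
Proof.
move=> /has_derivative_inP hI /has_derivative_inP hJ.
apply/has_derivative_inP => e e0.
have [r r0 rP] := hI e e0; have [s s0 sP] := hJ e e0.
exists (Num.min r s); first by rewrite lt_min r0.
by move=> t It; rewrite lt_min => /andP[]; case: It => It; [move=> + _|move=> _];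
  [exact: rP|exact: sP].
Qed.

(** At a common point both relative derivatives have the same value, because [phi] and [chi] agree
    there; at any other point only one of the two intervals matters nearby. *)
Lemma solution_glue (R : realType) (D : set (R * R)) f (I J : set R) phi chi z :
  I z -> J z -> (forall t, I t -> J t -> phi t = chi t) ->
  solution D f I phi -> solution D f J chi ->
  solution D f (I `|` J) (glue I phi chi).
Proof.
move=> Iz Jz e [aI sI] [aJ sJ].
have gI t : I t -> glue I phi chi t = phi t by exact: glue_in.
have gJ t : J t -> glue I phi chi t = chi t by exact: glue_right.
have dI t : I t -> has_derivative_in I (glue I phi chi) t (f (t, phi t)).
  move=> It; apply: has_derivative_in_eq It _ (sI _ It).2.
  by move=> u /[!inE] Iu; rewrite gI.
have dJ t : J t -> has_derivative_in J (glue I phi chi) t (f (t, chi t)).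
  move=> Jt; apply: has_derivative_in_eq Jt _ (sJ _ Jt).2.
  by move=> u /[!inE] Ju; rewrite gJ.
have [/angle_interval_is_interval II /angle_interval_is_interval IJ] := (aI, aJ).
split; first exact: angle_intervalU aI aJ Iz Jz.
move=> x; have [Ix|nIx] := pselect (I x); have [Jx|nJx] := pselect (J x) => IJx.
- rewrite gI//; split; first exact: (sI _ Ix).1.
  by apply: has_derivative_inU; [exact: dI|rewrite e//; exact: dJ].
- have [r r0 rP] := interval_setU_near II IJ Iz Jz Ix nJx.
  rewrite gI//; split; first exact: (sI _ Ix).1.
  exact: has_derivative_in_local r0 rP (dI _ Ix).
- have [r r0 rP] := interval_setU_near IJ II Jz Iz Jx nIx.
  rewrite gJ//; split; first exact: (sJ _ Jx).1.
  by apply: has_derivative_in_local r0 _ (dJ _ Jx); rewrite setUC.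
- by case: IJx.
Qed.

(** * Agreement of solutions *)

(* A Lipschitz condition on A need not extend to closure A: two points of
   closure A on a vertical line need not be limits of pairs of points of A on
   common vertical lines. Along the graphs of two solutions in closure A they
   are, and this is enough for uniqueness. *)
Definition lipschitz_along_solutions (R : realType) (D : set (R * R))
    (f : R * R -> R) (p : R * R) (c L : R) : Prop :=
  forall a b phi1 phi2 x,
    solution D f `]a, b[ phi1 -> solution D f `]a, b[ phi2 -> a < x < b ->
    `|x - p.1| < c -> `|phi1 x - p.2| < c -> `|phi2 x - p.2| < c ->
    `|f (x, phi1 x) - f (x, phi2 x)| <= L * `|phi1 x - phi2 x|.

Lemma angle_interval_oo (R : realType) (a b : R) :
  a < b -> angle_interval `]a, b[.
Proof. by move=> ab; exists a, b, false, false. Qed.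

Lemma angle_interval_co (R : realType) (a b : R) :
  a < b -> angle_interval `[a, b[.
Proof. by move=> ab; exists a, b, true, false. Qed.

Lemma angle_interval_oc (R : realType) (a b : R) :
  a < b -> angle_interval `]a, b].
Proof. by move=> ab; exists a, b, false, true. Qed.

Lemma ball_subset_itv_oo (R : realType) (s t x : R) : s < x < t ->
  exists2 e, 0 < e & ball x e `<=` `]s, t[.
Proof.
move=> /andP[sx xt]; exists (Num.min (x - s) (t - x)).
  by rewrite lt_min !subr_gt0 sx.
move=> y; rewrite /ball/= lt_min !ltr_norml in_itv/= => /andP[/andP[a b] /andP[d e]].
by apply/andP; split; lra.
Qed.

(** The mean value theorem for [phi - chi] needs derivatives only strictly between [s] and [t],
    where they are two-sided; at [s] and [t], possibly endpoints of [K], continuity relative to [K]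
    suffices. *)
Lemma solution_diff_mean_value (R : realType) (D : set (R * R)) f (K : set R)
    phi chi (s t : R) :
  solution D f K phi -> solution D f K chi -> K s -> K t -> s < t ->
  exists2 x, s < x < t & (phi t - chi t) - (phi s - chi s) =
    (f (x, phi x) - f (x, chi x)) * (t - s).
Proof.
move=> sphi schi Ks Kt st.
have stK u : s <= u <= t -> K u.
  by have /angle_interval_is_interval/(_ s t) := sphi.1; apply.
have ooK : `]s, t[ `<=` K.
  by move=> u; rewrite /= in_itv/= => /andP[su ut]; apply: stK; rewrite !ltW.
have [||x xst ->] := @MVT R (phi \- chi)
    (fun x => f (x, phi x) - f (x, chi x)) s t st.
- move=> x; rewrite in_itv/= => xst.
  have [e e0 eK] := ball_subset_itv_oo xst.
  have Kx : K x by apply: ooK; rewrite /= in_itv.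
  apply: is_deriveB; apply: (has_derivative_in_ball e0 (subset_trans eK ooK)).
  + exact: (sphi.2 _ Kx).2.
  + exact: (schi.2 _ Kx).2.
- apply/subspace_continuousP => x /=; rewrite in_itv/= => /stK Kx.
  apply/cvgrPdist_lt => e e0; have e20 : 0 < e / 2 by rewrite divr_gt0.
  have [r r0 rP] := solution_continuous sphi Kx e20.
  have [q q0 qP] := solution_continuous schi Kx e20.
  apply/nbhs_ballP; exists (Num.min r q) => /=; first by rewrite lt_min r0.
  move=> u; rewrite /ball/= lt_min distrC => /andP[ur uq].
  rewrite /= in_itv/= => /stK Ku.
  have := rP u Ku ur; have := qP u Ku uq; rewrite /from_subspace/= !ltr_norml => *.
  lra.
- by rewrite in_itv/= in xst; exists x.
Qed.

(** Only [chi] is assumed to stay in the box; [phi] starts from the same point and stays in it near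
    [s] by continuity. This asymmetry allows comparison with arbitrary solutions later. *)
Lemma solutions_agree_near (R : realType) (D : set (R * R)) f p c L
    (K : set R) phi chi s :
  0 <= L -> lipschitz_along_solutions D f p c L ->
  solution D f K phi -> solution D f K chi -> K s -> phi s = chi s ->
  (forall x, K x -> `|x - p.1| < c /\ `|chi x - p.2| < c) ->
  exists2 r, 0 < r & forall t, K t -> `|t - s| < r -> phi t = chi t.
Proof.
move=> L0 lip sphi schi Ks es box.
have [_ sc] := box _ Ks.
have [r1 r10 r1P] : exists2 r, 0 < r & forall t, K t -> `|t - s| < r ->
    `|phi t - phi s| < c - `|chi s - p.2|.
  by apply: solution_continuous sphi Ks _; rewrite subr_gt0.
have h0 : 0 < 2^-1 :> R by rewrite invr_gt0.
have [r2 r20 r2P] := solution_continuous sphi Ks h0.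
have [r3 r30 r3P] := solution_continuous schi Ks h0.
have L1 : 0 < 2 * (L + 1) by lra.
(* [r1] keeps [phi] in the box, [r2] and [r3] bound the initial difference by 1, and the last term
   makes [L * r] at most 1/2; [L + 1] covers the case [L = 0]. *)
pose r := Num.min (Num.min r1 r2) (Num.min r3 (2 * (L + 1))^-1).
exists r; first by rewrite !lt_min r10 r20 r30 invr_gt0.
have iK := angle_interval_is_interval sphi.1.
have phic t : K t -> `|t - s| < r -> `|phi t - p.2| < c.
  move=> Kt; rewrite !lt_min => /andP[/andP[/(r1P _ Kt) h _] _].
  rewrite -(subrK (phi s) (phi t)) -addrA (le_lt_trans (ler_normD _ _))//.
  by rewrite -ltrBrDr es in h *.
have step x u : K x -> `|x - s| < r -> K u -> `|u - s| < r -> x < u ->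
    exists2 v, x < v < u & `|(phi u - chi u) - (phi x - chi x)|
      <= L * `|phi v - chi v| * (u - x).
  move=> Kx xr Ku ur xu.
  have [v xvu ->] := solution_diff_mean_value sphi schi Kx Ku xu.
  have ooK : `]x, u[ `<=` K.
    move=> w; rewrite /= in_itv/= => /andP[xw wu].
    by apply: (iK x u) => //; rewrite !ltW.
  have Kv : K v by apply: ooK; rewrite /= in_itv.
  exists v => //; rewrite normrM [`|u - x|]gtr0_norm ?subr_gt0//.
  rewrite ler_wpM2r ?subr_ge0 ?(ltW xu)//.
  have vr : `|v - s| < r.
    by move: xr ur xvu; rewrite !ltr_norml; lra.
  apply: (lip x u phi chi v) => //.
  - exact: solution_sub sphi ooK (angle_interval_oo xu).
  - exact: solution_sub schi ooK (angle_interval_oo xu).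
  - exact: (box _ Kv).1.
  - exact: phic.
  - exact: (box _ Kv).2.
(* The mean value theorem halves any bound on the difference, since L * r <= 1/2. *)
have bound n : forall t, K t -> `|t - s| < r -> `|phi t - chi t| <= 2^-1 ^+ n.
  elim: n => [|n ih] t Kt tr.
    have : `|t - s| < r by [].
    rewrite !lt_min => /andP[/andP[_ /(r2P _ Kt) h2] /andP[/(r3P _ Kt) h3 _]].
    by move: h2 h3; rewrite es expr0 !ltr_norml ler_norml; lra.
  have half v d : K v -> `|v - s| < r -> 0 <= d -> d < r ->
      L * `|phi v - chi v| * d <= 2^-1 ^+ n.+1.
    move=> Kv vr d0; rewrite !lt_min => /andP[_ /andP[_ dr]].
    rewrite exprS mulrAC ler_pM ?mulr_ge0 ?ih//.
    have : (L + 1) * d <= (L + 1) * (2 * (L + 1))^-1.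
      by rewrite ler_wpM2l ?addr_ge0// ltW.
    have -> : (L + 1) * (2 * (L + 1))^-1 = 2^-1 by field; lra.
    by lra.
  have u0 : phi s - chi s = 0 by rewrite es subrr.
  have sr : `|s - s| < r by rewrite subrr normr0; apply: le_lt_trans tr.
  have [st|ts|<-] := ltgtP s t; last by rewrite u0 normr0 exprn_ge0.
  - have [v vst] := step _ _ Ks sr Kt tr st; rewrite u0 subr0 => /le_trans; apply.
    have Kv : K v by apply: (iK s t) => //; move: vst => /andP[? ?]; rewrite !ltW.
    apply: half => //; first by move: tr vst; rewrite !ltr_norml; lra.
      by rewrite subr_ge0 ltW.
    by move: tr; rewrite ltr_norml; lra.
  - have [v vst] := step _ _ Kt tr Ks sr ts; rewrite u0 sub0r normrN => /le_trans; apply.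
    have Kv : K v by apply: (iK t s) => //; move: vst => /andP[? ?]; rewrite !ltW.
    apply: half => //; first by move: tr vst; rewrite !ltr_norml; lra.
      by rewrite subr_ge0 ltW.
    by move: tr; rewrite ltr_norml; lra.
move=> t Kt tr; apply/eqP; rewrite -subr_eq0 -normr_le0.
have c0 : (2^-1 : R) ^+ n @[n --> \oo] --> 0.
  by apply: cvg_expr; rewrite ger0_norm ?invr_ge0// invf_lt1// ltr1n.
rewrite -(cvg_lim _ c0)//; apply: limr_ge; first by apply/cvg_ex; exists 0.
by near=> n; exact: bound.
Unshelve. all: by end_near. Qed.

Lemma solutions_agree (R : realType) (D : set (R * R)) f p c L (K : set R)
    phi chi x0 :
  0 <= L -> lipschitz_along_solutions D f p c L ->
  solution D f K phi -> solution D f K chi -> K x0 -> phi x0 = chi x0 ->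
  (forall x, K x -> `|x - p.1| < c /\ `|chi x - p.2| < c) ->
  forall x, K x -> phi x = chi x.
Proof.
move=> L0 lip sphi schi Kx0 e0 box.
pose B := [set t | K t /\ phi t = chi t].
suff BK : B = K by move=> x; rewrite -{1}BK => -[].
have /connected_intervalP cK := angle_interval_is_interval sphi.1.
apply: cK; first by exists x0.
- exists [set t | K t -> phi t = chi t]°; first exact: open_interior.
  rewrite predeqE => t; split=> [[Kt et]|[Kt /interior_subset/(_ Kt)]//].
  split=> //; have [r r0 rP] := solutions_agree_near L0 lip sphi schi Kt et box.
  apply/nbhs_ballP; exists r => //= u tu Ku; apply: rP => //.
  by rewrite distrC.
- exists (closure B); first exact: closed_closure.
  rewrite predeqE => t; split=> [Bt|[Kt Bt]].
    by split; [exact: Bt.1|exact: subset_closure].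
  split=> //; apply/eqP; rewrite -subr_eq0 -normr_le0; apply/ler_addgt0Pl => e e_gt0.
  rewrite addr0; have e2 : 0 < e / 2 by rewrite divr_gt0.
  have [r r0 rP] := solution_continuous sphi Kt e2.
  have [q q0 qP] := solution_continuous schi Kt e2.
  have [|u [[Ku eu]]] := Bt (ball t (Num.min r q)).
    by apply/nbhs_ballP; exists (Num.min r q) => //=; rewrite lt_min r0.
  rewrite /ball/= distrC lt_min => /andP[/(rP _ Ku) + /(qP _ Ku)].
  by rewrite eu !ltr_norml ler_norml; lra.
Qed.

(** Any solution agrees with [chi] on the common interval, so gluing [chi] to it extends it to [J].
    An extension is again a solution of the initial value problem, so it equals [chi] on [J]. *)
Lemma ivp_unique_on_box (R : realType) (D : set (R * R)) f p c L (J : set R) chi :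
  0 <= L -> lipschitz_along_solutions D f p c L -> ivp_solution D f p J chi ->
  (forall x, J x -> `|x - p.1| < c /\ `|chi x - p.2| < c) ->
  ivp_unique_on D f p J.
Proof.
move=> L0 lip [schi Jp chip] box.
have agree I phi : ivp_solution D f p I phi ->
    forall x, I x -> J x -> phi x = chi x.
  move=> [sphi Ip phip] x Ix Jx.
  (* Away from [p.1] the intersection contains the two points [x] and [p.1], so it is not
     degenerate. *)
  have [xp|/eqP xp] := eqVneq x p.1; first by rewrite xp phip.
  have aIJ : angle_interval (I `&` J).
    have /angle_intervalP[iI lI uI _] := sphi.1.
    have /angle_intervalP[iJ _ _ _] := schi.1.
    apply/angle_intervalP; split.
    - move=> u v [Iu Ju] [Iv Jv] w uwv.
      by split; [exact: (iI u v)|exact: (iJ u v)].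
    - by have [a ha] := lI; exists a => u [/ha].
    - by have [a ha] := uI; exists a => u [/ha].
    - have [xp1|px1|//] := ltgtP x p.1.
      + by exists x, p.1.
      + by exists p.1, x.
  apply: (@solutions_agree _ D f p c L (I `&` J) phi chi p.1) => //.
  - exact: solution_sub sphi (@subIsetl _ _ _) aIJ.
  - exact: solution_sub schi (@subIsetr _ _ _) aIJ.
  - by rewrite phip.
  - by move=> u [_ /box].
split=> [I phi ivp|I1 phi1 I2 phi2 psi1 psi2 i1 i2 [s1 e1] [s2 e2] x Jx].
  exists (glue I phi chi); split; last exact: glue_in.
  have [sphi Ip _] := ivp; apply: (solution_glue Ip Jp) => //.
  exact: agree.
rewrite (agree (I1 `|` J) psi1) ?(agree (I2 `|` J) psi2)//; try by right.
- have [_ I2p p2] := i2; split=> //; first by left.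
  by rewrite e2.
- have [_ I1p p1] := i1; split=> //; first by left.
  by rewrite e1.
Qed.

(** * Boundary points *)

(* The abscissas of the points of A close to the graph of phi1, and those of the
   points of A close to the graph of phi2, form two dense open sets. *)
Lemma closure_common_abscissa (R : realType) (D A : set (R * R)) f (a b : R)
    phi1 phi2 x e :
  open A -> solution (D `&` closure A) f `]a, b[ phi1 ->
  solution (D `&` closure A) f `]a, b[ phi2 -> a < x < b -> 0 < e ->
  exists t z1 z2, [/\ A (t, z1), A (t, z2), `|t - x| < e,
    `|z1 - phi1 x| < e & `|z2 - phi2 x| < e].
Proof.
move=> oA s1 s2 axb e0.
have Ix : [set` `]a, b[] x by rewrite /= in_itv.
have e20 : 0 < e / 2 by rewrite divr_gt0.
have [r r0 rP] := solution_continuous s2 Ix e20.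
have [d d0 dP] := ball_subset_itv_oo axb.
(* [r] keeps [phi2 t1] close to [phi2 x], and [d] keeps [t1] in the interval, so that the graph of
   [phi2] can be approximated over [t1]. *)
pose q := Num.min (Num.min r d) e.
have q0 : 0 < q by rewrite !lt_min r0 d0.
have [|[t1 z1] [At1]] := (s1.2 _ Ix).1.2 (ball (x, phi1 x) q).
  by apply/nbhs_ballP; exists q.
move=> []; rewrite /ball/= => t1q z1q; rewrite distrC in t1q; rewrite distrC in z1q.
have /nbhs_ballP[s /= s0 sA] := open_nbhs_nbhs (conj oA At1).
have It1 : [set` `]a, b[] t1.
  by apply: dP; rewrite /ball/= distrC; move: t1q; rewrite !lt_min => /andP[/andP[]].
(* [s] keeps [(t, z1)] in the open set [A] after the abscissa moves from [t1] to [t]; the second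
   term keeps [t] within [q] of [x]. *)
pose w := Num.min (Num.min s (q - `|t1 - x|)) (e / 2).
have w0 : 0 < w by rewrite !lt_min s0 e20 subr_gt0 t1q.
have [|[t z2] [Atz]] := (s2.2 _ It1).1.2 (ball (t1, phi2 t1) w).
  by apply/nbhs_ballP; exists w.
move=> []; rewrite /ball/= => tw z2w.
have [ts tq] : `|t1 - t| < s /\ `|t1 - t| < q - `|t1 - x|.
  by move: tw; rewrite !lt_min => /andP[/andP[-> ->]].
have tx : `|t - x| < q.
  rewrite -(subrK t1 t) -addrA (le_lt_trans (ler_normD _ _))// distrC.
  by rewrite -ltrBrDr.
exists t, z1, z2; split => //.
- by apply: sA; split => //=; exact: ballxx.
- by move: tx; rewrite lt_min => /andP[].
- by move: z1q; rewrite lt_min => /andP[].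
- have {}z2w : `|z2 - phi2 t1| < e / 2.
    by rewrite distrC; move: z2w; rewrite lt_min => /andP[].
  have : `|phi2 t1 - phi2 x| < e / 2.
    by apply: rP => //; move: t1q; rewrite !lt_min => /andP[/andP[]].
  by move: z2w; rewrite !ltr_norml; lra.
Qed.

(** The bound holds for pairs of points of [A] on a common vertical line approximating the two graph
    points, and passes to the limit by continuity of [f]. *)
Lemma lipschitz_along_solutions_closure (R : realType) (D A : set (R * R))
    (f : R * R -> R) p (c L : R) :
  open A -> A `<=` D -> {within D, continuous f} -> 0 <= L ->
  (forall x y1 y2, A (x, y1) -> A (x, y2) ->
    `|x - p.1| <= c -> `|y1 - p.2| <= c -> `|y2 - p.2| <= c ->
    `|f (x, y1) - f (x, y2)| <= L * `|y1 - y2|) ->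
  lipschitz_along_solutions (D `&` closure A) f p c L.
Proof.
move=> oA AD /subspace_continuousP fc L0 lip a b phi1 phi2 x s1 s2 axb xc y1c y2c.
have Ix : [set` `]a, b[] x by rewrite /= in_itv.
have fnear y e : D (x, y) -> 0 < e -> exists2 r, 0 < r &
    forall t z, A (t, z) -> `|t - x| < r -> `|z - y| < r ->
      `|f (x, y) - f (t, z)| < e.
  move=> Dxy e0; have /cvgrPdist_lt/(_ e e0)/nbhs_ballP[r /= r0 rP] := fc _ Dxy.
  exists r => // t z Atz tx zy; apply: rP; last exact: AD.
  by split; rewrite /ball/= distrC.
apply/ler_addgt0Pl => e e0.
have e40 : 0 < e / 4 by rewrite divr_gt0.
have [r1 r10 r1P] := fnear _ _ (s1.2 _ Ix).1.1 e40.
have [r2 r20 r2P] := fnear _ _ (s2.2 _ Ix).1.1 e40.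
have L1 : 0 < 4 * (L + 1) by lra.
(* [r1] and [r2] cost e/4 each, and e/(4(L + 1)) makes the shift of the ordinates cost at most e/2.
   The other terms, positive by the strict box inequalities, keep the approximating points in the
   closed box. *)
pose d := Num.min (Num.min (Num.min r1 r2) (Num.min (c - `|x - p.1|) (e / (4 * (L + 1)))))
  (Num.min (c - `|phi1 x - p.2|) (c - `|phi2 x - p.2|)).
have d0 : 0 < d by rewrite !lt_min r10 r20 !subr_gt0 xc y1c y2c divr_gt0.
have [t [z1 [z2 [A1 A2]]]] := closure_common_abscissa oA s1 s2 axb d0.
have near (u v w : R) : `|w - v| < c - `|v - u| -> `|w - u| <= c.
  move=> h; rewrite -(subrK v w) -addrA (le_trans (ler_normD _ _))//.
  by rewrite -lerBrDr ltW.
rewrite !lt_min -!andbA => /and5P[t1 t2 t3 _ /andP[_ _]].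
move=> /and5P[z11 _ _ z14 /andP[z15 _]] /and5P[_ z22 _ z24 /andP[_ z26]].
have f1 := r1P _ _ A1 t1 z11; have f2 := r2P _ _ A2 t2 z22.
have := lip _ _ _ A1 A2 (near _ _ _ t3) (near _ _ _ z15) (near _ _ _ z26).
have : L * `|z1 - z2| <= L * (`|phi1 x - phi2 x| + 2 * (e / (4 * (L + 1)))).
  rewrite ler_wpM2l//.
  have -> : z1 - z2 = (z1 - phi1 x) + ((phi1 x - phi2 x) + - (z2 - phi2 x)) by ring.
  rewrite (le_trans (ler_normD _ _))// (le_trans (lerD (lexx _) (ler_normD _ _)))//.
  by rewrite normrN; move: z14 z24; lra.
have : (L + 1) * (2 * (e / (4 * (L + 1)))) = e / 2 by field; lra.
have : 0 < e / (4 * (L + 1)) by rewrite divr_gt0.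
set k := e / (4 * _) => k0 kE h1 h2.
have -> : f (x, phi1 x) - f (x, phi2 x) = (f (x, phi1 x) - f (t, z1)) +
  ((f (t, z1) - f (t, z2)) + - (f (x, phi2 x) - f (t, z2))) by ring.
rewrite (le_trans (ler_normD _ _))// (le_trans (lerD (lexx _) (ler_normD _ _)))//.
by rewrite normrN; move: f1 f2; lra.
Qed.

Lemma ivp_solution_near (R : realType) (D : set (R * R)) f p I phi c :
  0 < c -> ivp_solution D f p I phi ->
  exists2 r, 0 < r & forall t, I t -> `|t - p.1| < r ->
    `|t - p.1| < c /\ `|phi t - p.2| < c.
Proof.
move=> c0 [s Ip <-]; have [r r0 rP] := solution_continuous s Ip c0.
exists (Num.min r c); first by rewrite lt_min r0.
by move=> t It; rewrite lt_min => /andP[tr tc]; split => //; exact: rP.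
Qed.

Lemma ivp_solution_sub (R : realType) (D : set (R * R)) f p (I J : set R) phi :
  J `<=` I -> J p.1 -> angle_interval J -> ivp_solution D f p I phi ->
  ivp_solution D f p J phi.
Proof. by move=> JI Jp aJ [s _ e]; split => //; exact: solution_sub s _ aJ. Qed.

Section one_sided.
Variables (R : realType) (D : set (R * R)) (f : R * R -> R) (p : R * R) (c L : R).
Hypotheses (c0 : 0 < c) (L0 : 0 <= L) (lip : lipschitz_along_solutions D f p c L).

(** The given solution, cut down to a short [[p.1, b[] on which it stays in the box, serves as the
    reference solution. *)
Lemma right_solution_unique I phi z :
  ivp_solution D f p I phi -> I z -> p.1 < z -> right_locally_unique D f p.
Proof.
move=> sphi Iz pz; have [s Ip _] := sphi.
have [r r0 rP] := ivp_solution_near c0 sphi.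
pose b := Num.min z (p.1 + r).
have pb : p.1 < b by rewrite lt_min pz ltrDl.
have bI : `[p.1, b[ `<=` I.
  move=> t /=; rewrite in_itv/= lt_min => /andP[pt /andP[tz _]].
  by apply: (angle_interval_is_interval s.1 Ip Iz); rewrite pt ltW.
have sb : ivp_solution D f p `[p.1, b[ phi.
  apply: ivp_solution_sub bI _ (angle_interval_co pb) sphi.
  by rewrite /= in_itv/= lexx.
split; first by exists b, phi.
exists b; split => //; apply: ivp_unique_on_box L0 lip sb _ => t tb.
apply: rP; first exact: bI.
move: tb; rewrite /= in_itv/= lt_min => /andP[pt /andP[_ tr]].
by rewrite ger0_norm ?subr_ge0// ltrBlDl.
Qed.

Lemma left_solution_unique I phi z :
  ivp_solution D f p I phi -> I z -> z < p.1 -> left_locally_unique D f p.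
Proof.
move=> sphi Iz zp; have [s Ip _] := sphi.
have [r r0 rP] := ivp_solution_near c0 sphi.
pose a := Num.max z (p.1 - r).
have ap : a < p.1 by rewrite gt_max zp gtrBl.
have aI : `]a, p.1] `<=` I.
  move=> t /=; rewrite in_itv/= gt_max => /andP[/andP[zt _] tp].
  by apply: (angle_interval_is_interval s.1 Iz Ip); rewrite tp ltW.
have sa : ivp_solution D f p `]a, p.1] phi.
  apply: ivp_solution_sub aI _ (angle_interval_oc ap) sphi.
  by rewrite /= in_itv/= lexx andbT.
split; first by exists a, phi.
exists a; split => //; apply: ivp_unique_on_box L0 lip sa _ => t ta.
apply: rP; first exact: aI.
move: ta; rewrite /= in_itv/= gt_max => /andP[/andP[_ tr] tp].
by rewrite distrC ger0_norm ?subr_ge0// ltrBlDr -ltrBlDl.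
Qed.

Lemma extendable_right_solution : extendable_right D f p ->
  exists I phi z, [/\ ivp_solution D f p I phi, I z & p.1 < z].
Proof.
move=> [I [phi [b [[_ Ip ep] pb [psi [spsi e]]]]]].
exists (I `|` `[p.1, b]), psi, b; split => //.
  by split => //; [left|rewrite e].
by right; rewrite /= in_itv/= lexx andbT ltW.
Qed.

Lemma extendable_left_solution : extendable_left D f p ->
  exists I phi z, [/\ ivp_solution D f p I phi, I z & z < p.1].
Proof.
move=> [I [phi [a [[_ Ip ep] ap [psi [spsi e]]]]]].
exists (I `|` `[a, p.1]), psi, a; split => //.
  by split => //; [left|rewrite e].
by right; rewrite /= in_itv/= lexx ltW.
Qed.

Lemma lipschitz_along_boundary_uniqueness_point :
  boundary_uniqueness_point D f p.
Proof.
have [hr|nr] := pselect (exists I phi z,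
  [/\ ivp_solution D f p I phi, I z & p.1 < z]);
have [hl|nl] := pselect (exists I phi z,
  [/\ ivp_solution D f p I phi, I z & z < p.1]).
- have [I [phi [z [s Iz pz]]]] := hr; have [J [psi [w [t Jw wp]]]] := hl.
  apply: Or43; split; first exact: left_solution_unique t Jw wp.
  exact: right_solution_unique s Iz pz.
- have [I [phi [z [s Iz pz]]]] := hr.
  apply: Or42; split; first exact: right_solution_unique s Iz pz.
  by move=> /extendable_left_solution.
- have [J [psi [w [t Jw wp]]]] := hl.
  apply: Or41; split; first exact: left_solution_unique t Jw wp.
  by move=> /extendable_right_solution.
- apply: Or44 => -[I [phi s]].
  (* The interval of a solution has two distinct points, so it contains a point to the left or to
     the right of [p.1]. *)
  have [[/angle_intervalP[_ _ _ [x [y [Ix Iy xy]]]] _] _ _] := s.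
  have [xp|px] := ltP x p.1; first by apply: nl; exists I, phi, x.
  by apply: nr; exists I, phi, y; split => //; exact: le_lt_trans px xy.
Qed.

End one_sided.

(** * Picard iteration *)

(** For [0 <= r], the nearest-point projection onto the segment of radius [r] about [a]. It turns
    data on a box into data defined everywhere. *)
Definition clamp (R : realType) (a r x : R) : R := Num.max (a - r) (Num.min (a + r) x).

Lemma clamp_bound (R : realType) (a r x : R) : 0 <= r -> `|clamp a r x - a| <= r.
Proof.
move=> r0; rewrite ler_distl /clamp le_max lexx/= ge_max ge_min lexx/= andbT.
by lra.
Qed.

Lemma clamp_id (R : realType) (a r x : R) : `|x - a| <= r -> clamp a r x = x.
Proof.
rewrite ler_distl => /andP[ax xa].
by rewrite /clamp (min_idPr xa) (max_idPr ax).
Qed.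

Lemma clamp_continuous (R : realType) (a r : R) : continuous (clamp a r).
Proof.
move=> x; apply: (@continuous_max _ _ (cst (a - r)) (cst (a + r) \min id)).
  exact: cst_continuous.
by apply: continuous_min; [exact: cst_continuous|exact: cvg_id].
Qed.

Lemma derive_bound (R : realType) (U u : R -> R) (a r k x : R) :
  (forall t, `|t - a| <= r -> is_derive t 1 U (u t)) ->
  (forall t, `|u t| <= k) -> `|x - a| <= r -> `|U x - U a| <= k * `|x - a|.
Proof.
move=> dU uk xr.
have mvt s t : s < t -> `|s - a| <= r -> `|t - a| <= r ->
    `|U t - U s| <= k * `|t - s|.
  move=> st sr tr.
  have stU v : v \in `[s, t] -> is_derive v 1 U (u v).
    rewrite in_itv/= => /andP[sv vt]; apply: dU.
    by move: sr tr; rewrite !ler_norml; lra.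
  have dst v : v \in `]s, t[ -> is_derive v 1 U (u v).
    rewrite in_itv/= => /andP[sv vt]; apply: stU.
    by rewrite in_itv/= !ltW.
  have cst : {within `[s, t], continuous U}.
    apply: derivable_within_continuous => v vst.
    by have [] := stU v vst.
  have [v _ ->] := MVT st dst cst.
  by rewrite normrM ler_wpM2r.
have ar : `|a - a| <= r by rewrite subrr normr0 (le_trans (normr_ge0 _) xr).
have [xa|ax|->] := ltgtP x a; last by rewrite !subrr normr0 mulr0.
  by rewrite distrC [`|x - a|]distrC; exact: mvt.
exact: mvt.
Qed.

Section picard_lindelof.
Variables (R : realType) (x0 y0 h M L : R) (g : R -> R -> R).
Hypotheses (h0 : 0 < h) (M0 : 0 <= M) (L0 : 0 <= L) (Lh : L * h <= 2^-1).
Hypothesis g_cont : forall u, continuous u -> continuous (fun x => g x (u x)).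
Hypothesis g_bound : forall x y, `|g x y| <= M.
Hypothesis g_lip : forall x y z, `|g x y - g x z| <= L * `|y - z|.

(** The base point lies strictly to the left of the segment of radius [h] about [x0], so that the
    primitive has a two-sided derivative even at the ends of that segment. *)
Let I (v : R -> R) x := \int[lebesgue_measure]_(t in `[x0 - 2 * h, x]) v t.

Let I_derive (v : R -> R) (t : R) : continuous v -> `|t - x0| <= h -> is_derive t 1 (I v) (v t).
Proof.
move=> cv; rewrite ler_distl => /andP[xt tx].
have tu : t < x0 + 2 * h by move: h0; lra.
have [] := @continuous_FTC1_closed R v (x0 - 2 * h) t _ tu.
- apply: continuous_compact_integrable; first exact: segment_compact.
  exact: continuous_subspaceT.
- by move: h0; lra.
- exact: cv.
- move=> dI Ie; apply: DeriveDef; first exact: dI.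
  by rewrite -derive1E; exact: Ie.
Qed.

(** The Picard operator; the integral from [x0] is a difference of two values of [I]. Clamping makes
    [T u] constant outside the segment, so uniform bounds hold on the whole line. *)
Let T u x := y0 + (I (fun t => g t (u t)) (clamp x0 h x) - I (fun t => g t (u t)) x0).

Let T_derive (u : R -> R) (x : R) : continuous u -> `|x - x0| < h ->
  is_derive x 1 (T u) (g x (u x)).
Proof.
move=> cu xh; have dI := I_derive (g_cont cu) (ltW xh).
pose F := cst y0 + (I (fun t => g t (u t)) - cst (I (fun t => g t (u t)) x0)).
have dF : is_derive x 1 F (g x (u x)).
  have -> : g x (u x) = 0 + (g x (u x) - 0) by rewrite subr0 add0r.
  by apply: is_deriveD; apply: is_deriveB.
apply: near_eq_is_derive dF => //.
have : ball x (h - `|x - x0|) `<=` [set t | F t = T u t].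
  move=> t; rewrite /ball/= distrC => tx; rewrite /T clamp_id//.
  rewrite -(subrK x t) -addrA (le_trans (ler_normD _ _))//.
  by rewrite -lerBrDr ltW.
move=> sub; apply: filterS sub _; apply: nbhsx_ballx.
by rewrite subr_gt0.
Qed.

Let T_continuous u : continuous u -> continuous (T u).
Proof.
move=> cu x; apply: cvgD; first exact: cvg_cst.
apply: cvgB; last exact: cvg_cst.
apply: (@continuous_comp _ _ _ (clamp x0 h) (I _)); first exact: clamp_continuous.
have [d _] := I_derive (g_cont cu) (clamp_bound x0 x (ltW h0)).
by apply: differentiable_continuous; apply/derivable1_diffP.
Qed.

Let T_x0 u : T u x0 = y0.
Proof. by rewrite /T clamp_id ?subrr ?addr0// normr0 ltW. Qed.

Let T_bound u x : continuous u -> `|T u x - y0| <= M * h.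
Proof.
move=> cu; rewrite /T [y0 + _]addrC addrK.
have ch := clamp_bound x0 x (ltW h0).
apply: (le_trans (derive_bound (fun t => I_derive (g_cont cu)) _ ch)).
  by move=> t; exact: g_bound.
by rewrite ler_wpM2l.
Qed.

(** The difference of the two primitives has derivative at most [L * k] in absolute value, over a
    length at most [h], and [L * h] is at most 1/2. *)
Let T_contract u v k x : continuous u -> continuous v ->
  (forall t, `|u t - v t| <= k) -> `|T u x - T v x| <= 2^-1 * k.
Proof.
move=> cu cv uvk.
have k0 : 0 <= k by exact: le_trans (uvk x0).
have ch := clamp_bound x0 x (ltW h0).
pose W := I (fun t => g t (u t)) - I (fun t => g t (v t)).
have -> : T u x - T v x = W (clamp x0 h x) - W x0.
  by rewrite /T /W /=; rewrite !fctE; ring.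
have dW t : `|t - x0| <= h -> is_derive t 1 W (g t (u t) - g t (v t)).
  move=> th; have d1 := I_derive (g_cont cu) th.
  by have d2 := I_derive (g_cont cv) th; exact: is_deriveB.
apply: (le_trans (derive_bound dW _ ch)).
  by move=> t; apply: (le_trans (g_lip _ _ _)); exact: (ler_wpM2l L0 (uvk t)).
rewrite (@le_trans _ _ (L * k * h)) ?ler_wpM2l ?mulr_ge0//.
by rewrite mulrAC ler_wpM2r.
Qed.

Let u n := iter n T (cst y0).

Let u_continuous n : continuous (u n).
Proof.
elim: n => [|n ih]; first exact: cst_continuous.
exact: T_continuous.
Qed.

Let u_dist n x : `|u n.+1 x - u n x| <= M * h * 2^-1 ^+ n.
Proof.
elim: n x => [|n ih] x; first by rewrite expr0 mulr1; exact/T_bound/cst_continuous.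
by rewrite exprS mulrCA; apply: T_contract ih; exact: u_continuous.
Qed.

Let C := 2 * (M * h).
Let C0 : 0 <= C. Proof. by rewrite mulr_ge0// mulr_ge0// ltW. Qed.

Let u_dist_add n m x : `|u (n + m) x - u n x| <= C * 2^-1 ^+ n.
Proof.
(* Subtracting the tail of the geometric series makes the bound telescope, so that induction on [m]
   goes through. *)
suff : `|u (n + m) x - u n x| <= C * 2^-1 ^+ n - C * 2^-1 ^+ (n + m).
  by move=> /le_trans; apply; rewrite gerBl mulr_ge0// exprn_ge0.
elim: m => [|m ih]; first by rewrite addn0 !subrr normr0.
rewrite addnS -(subrK (u (n + m) x) (u _ x)) -addrA (le_trans (ler_normD _ _))//.
have := u_dist (n + m) x; move: ih; rewrite exprS /C; move: h0; lra.
Qed.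

Let pow0 : C * 2^-1 ^+ n @[n --> \oo] --> 0.
Proof.
rewrite -(mulr0 C); apply: cvgMl_tmp.
by apply: cvg_expr; rewrite ger0_norm ?invr_ge0// invf_lt1// ltr1n.
Qed.

Let small e : 0 < e -> exists n, C * 2^-1 ^+ n < e.
Proof.
move=> e0; have /cvgrPdist_lt/(_ e e0)[n _ /(_ n)] := pow0.
have Cn : 0 <= C * 2^-1 ^+ n by rewrite mulr_ge0 ?C0 ?exprn_ge0.
rewrite sub0r normrN ger0_norm// => /(_ (leqnn n)) ?.
by exists n.
Qed.

Let u_cvg x : cvg (u n x @[n --> \oo]).
Proof.
apply/cauchy_cvgP; apply: cauchy_exP => e e0; have [n ne] := small e0.
exists (u n x); exists n => // m /= nm; rewrite /ball/= distrC -(subnKC nm).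
exact: le_lt_trans (u_dist_add _ _ _) ne.
Qed.

Let phi x := lim (u n x @[n --> \oo]).

Let phi_dist n x : `|phi x - u n x| <= C * 2^-1 ^+ n.
Proof.
have c : `|u m x - u n x| @[m --> \oo] --> `|phi x - u n x|.
  by apply: cvg_norm; apply: cvgB; [exact: u_cvg|exact: cvg_cst].
rewrite -(cvg_lim _ c)//; apply: limr_le; first by apply/cvg_ex; eexists; exact: c.
by exists n => // m /= nm; rewrite -(subnKC nm).
Qed.

Let phi_continuous : continuous phi.
Proof.
move=> x; apply/cvgrPdist_lt => e e0.
have e3 : 0 < e / 3 by rewrite divr_gt0.
have [n ne] := small e3.
have /cvgrPdist_lt/(_ _ e3) := @u_continuous n x.
apply: filterS => t; have := phi_dist n x; have := phi_dist n t.
by rewrite !ler_norml !ltr_norml; move: ne; lra.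
Qed.

(** Both sides lie within [C / 2^(n+1)] of the iterate [u n.+1]: the left by [phi_dist], the right
    by contraction from [u n]. *)
Let phi_fix x : phi x = T phi x.
Proof.
apply/eqP; rewrite -subr_eq0 -normr_le0; apply/ler_addgt0Pl => e /small[n ne].
rewrite addr0.
have h1 : `|T phi x - u n.+1 x| <= 2^-1 * (C * 2^-1 ^+ n).
  by apply: T_contract => // t; exact: phi_dist.
have := phi_dist n.+1 x; move: h1 ne; rewrite exprS !ler_norml; lra.
Qed.

Lemma picard_lindelof : exists phi : R -> R, [/\ phi x0 = y0,
  forall x, `|x - x0| < h -> is_derive x 1 phi (g x (phi x)) &
  forall x, `|phi x - y0| <= M * h].
Proof.
have phiE : phi = T phi by apply/funext.
exists phi; split.
- by rewrite phi_fix.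
- by move=> x xh; rewrite {1}phiE; exact: T_derive.
- by move=> x; rewrite phi_fix; exact: T_bound.
Qed.

End picard_lindelof.

(** * Interior points *)

Lemma is_derive_has_derivative_in (R : realType) (I : set R) (phi : R -> R) (x d : R) :
  is_derive x 1 phi d -> has_derivative_in I phi x d.
Proof.
move=> [dphi dE]; apply/has_derivative_inP => e e0.
have : h^-1 *: ((phi \o shift x) (h *: 1) - phi x) @[h --> 0^'] --> d.
  by rewrite -dE; exact: dphi.
move=> /cvgrPdist_le/(_ e e0)/nbhs_ballP[r /= r0 rP].
exists r => // t It tr.
have [->|tx] := eqVneq t x; first by rewrite !subrr mulr0 subrr normr0 mulr0.
have tx0 : t - x != 0 by rewrite subr_eq0.
have := rP (t - x); rewrite /ball/= sub0r normrN => /(_ tr tx0).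
rewrite /GRing.scale/= mulr1 subrK => tdx.
have -> : phi t - phi x - d * (t - x) =
    - (d - (t - x)^-1 * (phi t - phi x)) * (t - x) by field.
by rewrite normrM normrN ler_wpM2r.
Qed.

Lemma clamp_dist (R : realType) (a r x y : R) :
  `|clamp a r x - clamp a r y| <= `|x - y|.
Proof.
have h1 := ler_norm (x - y); have h2 := ler_norm (y - x).
have h3 := normr_ge0 (x - y); rewrite distrC in h2.
rewrite /clamp ler_norml.
case: (leP (a + r) x) => ?; case: (leP (a + r) y) => ?;
  case: (leP (a - r) (a + r)) => ?; case: (leP (a - r) x) => ?;
  case: (leP (a - r) y) => ?; apply/andP; split; lra.
Qed.

(** Clamping both variables to a small box gives a right-hand side bounded and Lipschitz everywhere.
    Its Picard solution stays in the box, where clamping changes nothing, so it solves the original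
    equation. *)
Lemma lipschitz_interior_uniqueness_point (R : realType) (D A : set (R * R))
    (f : R * R -> R) p c L :
  open A -> A `<=` D -> {within D, continuous f} -> A p -> 0 < c -> 0 < L ->
  (forall x y1 y2, A (x, y1) -> A (x, y2) ->
    `|x - p.1| <= c -> `|y1 - p.2| <= c -> `|y2 - p.2| <= c ->
    `|f (x, y1) - f (x, y2)| <= L * `|y1 - y2|) ->
  interior_uniqueness_point D f p.
Proof.
move=> oA AD fc Ap c0 L0 lip.
have fA q : A q -> {for q, continuous f}.
  have := continuous_subspaceW AD fc; rewrite continuous_open_subspace// => h Aq.
  by apply: h; rewrite inE.
have /nbhs_ballP[r1 /= r10 r1A] := open_nbhs_nbhs (conj oA Ap).
have /cvgrPdist_lt/(_ 1 ltr01)/nbhs_ballP[r2 /= r20 r2f] := fA _ Ap.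
(* Halving puts the closed box of radius [r] inside the open balls of radii [r1] and [r2]. *)
pose r := Num.min c (Num.min r1 r2) / 2.
have m0 : 0 < Num.min c (Num.min r1 r2) by rewrite !lt_min c0 r10.
have r0 : 0 < r by rewrite divr_gt0.
have rm : r < Num.min c (Num.min r1 r2) by rewrite /r; lra.
move: rm; rewrite !lt_min => /and3P[rc rr1 rr2].
have boxA x y : `|x - p.1| <= r -> `|y - p.2| <= r -> A (x, y).
  move=> xr yr; apply: r1A; split; rewrite /ball/= distrC.
    exact: le_lt_trans rr1.
  exact: le_lt_trans rr1.
pose M := `|f p| + 1.
have boxM x y : `|x - p.1| <= r -> `|y - p.2| <= r -> `|f (x, y)| <= M.
  move=> xr yr; have : `|f p - f (x, y)| < 1.
    apply: r2f; split; rewrite /ball/= distrC; first exact: le_lt_trans rr2.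
    exact: le_lt_trans rr2.
  rewrite distrC => /ltW h; rewrite -(subrK (f p) (f (x, y))) addrC.
  by rewrite (le_trans (ler_normD _ _))// lerD2l.
have M1 : 1 <= M by rewrite lerDr.
have M0 : 0 < M by lra.
(* The first term keeps the solution within [r / 2] of [p.2]; the second makes the Picard operator
   contract by 1/2. *)
pose h := Num.min (r / (2 * M)) (2 * L)^-1.
have h0 : 0 < h by rewrite lt_min divr_gt0 ?mulr_gt0//= invr_gt0 mulr_gt0.
have Mh : M * h < r.
  apply: (@le_lt_trans _ _ (M * (r / (2 * M)))).
    by rewrite ler_wpM2l ?(ltW M0)// ge_min lexx.
  have -> : M * (r / (2 * M)) = r / 2 by field; lra.
  lra.
have hr : h < r by apply: le_lt_trans Mh; rewrite ler_peMl// ltW.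
have Lh : L * h <= 2^-1.
  apply: (@le_trans _ _ (L * (2 * L)^-1)).
    by rewrite ler_wpM2l ?(ltW L0)// ge_min lexx orbT.
  by have -> : L * (2 * L)^-1 = 2^-1 by field; lra.
have cl a x : `|clamp a r x - a| <= r by exact: clamp_bound (ltW r0).
pose g x y := f (clamp p.1 r x, clamp p.2 r y).
have g_cont u : continuous u -> continuous (fun x => g x (u x)).
  move=> cu x.
  apply: (@continuous_comp _ _ _ (fun x => (clamp p.1 r x, clamp p.2 r (u x))) f).
    have c1 : {for x, continuous (clamp p.1 r)} by exact: clamp_continuous.
    have c2 : {for x, continuous (clamp p.2 r \o u)}.
      by apply: continuous_comp; [exact: cu|exact: clamp_continuous].
    exact: cvg_pair c1 c2.
  by apply: fA; apply: boxA; exact: cl.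
have g_bound x y : `|g x y| <= M by apply: boxM; exact: cl.
have g_lip x y z : `|g x y - g x z| <= L * `|y - z|.
  apply: (@le_trans _ _ (L * `|clamp p.2 r y - clamp p.2 r z|)).
    apply: lip; try exact: boxA.
    - exact: le_trans (cl _ _) (ltW rc).
    - exact: le_trans (cl _ _) (ltW rc).
    - exact: le_trans (cl _ _) (ltW rc).
  by rewrite ler_wpM2l ?(ltW L0)// clamp_dist.
have [phi [phi0 dphi phib]] :=
  picard_lindelof p.1 p.2 h0 (ltW M0) (ltW L0) Lh g_cont g_bound g_lip.
(* The whole box lies in [A], so the Lipschitz condition applies directly at all its points. *)
have alip : lipschitz_along_solutions D f p r L.
  move=> a b phi1 phi2 x _ _ _ xr y1 y2.
  apply: lip; try by [apply: boxA; exact: ltW]; apply: ltW; exact: lt_trans rc.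
have inJ x : [set` `]p.1 - h, p.1 + h[] x -> `|x - p.1| < h.
  by rewrite /= in_itv/= ltr_distl.
exists (p.1 - h), (p.1 + h); split; [by rewrite gtrBl|by rewrite ltrDl|].
apply: (ivp_unique_on_box (ltW L0) alip (chi := phi)); last first.
  move=> x /inJ xh; split; first exact: lt_trans hr.
  exact: le_lt_trans Mh.
split => //; last by rewrite /= in_itv/= gtrBl h0 ltrDl.
split; first by apply: angle_interval_oo; lra.
move=> x /inJ xh.
have xr : `|x - p.1| <= r by rewrite ltW// (lt_trans xh).
have pr : `|phi x - p.2| <= r by rewrite ltW// (le_lt_trans (phib x)).
split; first by apply: AD; exact: boxA.
apply: is_derive_has_derivative_in.
by have := dphi x xh; rewrite /g !clamp_id.
Qed.

Theorem mainTheorem2 (R : realType) (G Gh : set (R * R)) (f : R * R -> R)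
  (G_open : open G) (G_connected : connected G)
  (Gh_boundary : Gh `<=` boundary G)
  (Gh_maximal : forall p, boundary G p -> limit_exists_at f G p -> Gh p)
  (f_continuous : {within G `|` Gh, continuous f})
  (Go Goh : set (R * R))
  (Go_open : open Go) (Go_connected : connected Go) (Go_sub : Go `<=` G)
  (Goh_sub : Goh `<=` boundary Go `&` Gh)
  (f_lipschitz : locally_lipschitz_in_y f (Go `|` Goh)) :
  uniqueness_set G Gh f Go Goh.
Proof.
have GoD : Go `<=` G `|` Gh by move=> p /Go_sub; left.
(* Around points of both kinds the condition is kept only for pairs in the open set [Go]; at
   boundary points it is carried to the closure along solutions. *)
have lip p : (Go `|` Goh) p -> exists c L : R, [/\ 0 < c, 0 < L &
    forall x y1 y2, Go (x, y1) -> Go (x, y2) ->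
      `|x - p.1| <= c -> `|y1 - p.2| <= c -> `|y2 - p.2| <= c ->
      `|f (x, y1) - f (x, y2)| <= L * `|y1 - y2|].
  case: p => x0 y0 /f_lipschitz[c [L [c0 L0 h]]]; exists c, L; split => //.
  by move=> x y1 y2 A1 A2; apply: h; left.
split=> p pG.
  have [c [L [c0 L0 h]]] := lip p (or_introl pG).
  exact: lipschitz_interior_uniqueness_point Go_open GoD f_continuous pG c0 L0 h.
have [c [L [c0 L0 h]]] := lip p (or_intror pG).
apply: lipschitz_along_boundary_uniqueness_point c0 (ltW L0) _.
exact: lipschitz_along_solutions_closure (ltW L0) h.
Qed.
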